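(* Let $\Psi:\mathbb{R}^n\to\mathbb{R}\cup\{\infty\}$ be proper, closed, and convex, and let $B\in\mathbb{R}^{n\times n}$ be positive definite. For all $x,g,e\in\mathbb{R}^n$ and $\delta\geq 0$, we have the inclusion $$\mathrm{Prox}_\Psi^B(x,g+e,\delta)\subseteq\mathrm{Prox}_\Psi^B\left(x,\,g,\,\delta+\sqrt{2\delta}\,\|e\|_B^*+\frac{1}{2}\left(\|e\|_B^*\right)^2\right).$$
   Context: $\langle\cdot,\cdot\rangle$ is an inner product on $\mathbb{R}^n$. Positive definite means self-adjoint with respect to $\langle\cdot,\cdot\rangle$ with $\langle Bx,x\rangle>0$ for $x\neq 0$. $\|\cdot\|_B$ is the norm induced by the inner product $(x,y)\mapsto\langle Bx,y\rangle$, and $\|\cdot\|_B^*$ is its dual norm, which equals $\|\cdot\|_{B^{-1}}$. For $x,g\in\mathbb{R}^n$ and $\delta\geq 0$, the inexact pre-conditioned proximal map is the set $$\mathrm{Prox}^B_\Psi(x,g,\delta):=\Big\{y\in\mathbb{R}^n: \langle g,y\rangle+\tfrac12\|y-x\|_B^2+\Psi(y)\leq\min_{z\in\mathbb{R}^n}\big\{\langle g,z\rangle+\tfrac12\|z-x\|_B^2+\Psi(z)\big\}+\delta\Big\}.$$ *)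

(* Defs.v *)
From mathcomp Require Import all_boot all_order all_algebra.
From mathcomp Require Import all_classical all_reals all_analysis.

Set Implicit Arguments.
Unset Strict Implicit.
Unset Printing Implicit Defensive.

Import Order.TTheory GRing.Theory Num.Theory.
Import numFieldNormedType.Exports.

Local Open Scope classical_set_scope.
Local Open Scope ring_scope.

Section ExtendedRealValuedFunctions.
Context {R : realType} {n : nat}.
Implicit Type Psi : 'cV[R]_n -> \bar R.
Local Open Scope ereal_scope.

(* The first conjunct says that Psi takes its values in R `|` {+oo}. *)
Definition proper_fun Psi : Prop :=
  (forall x, Psi x != -oo) /\ (exists x, Psi x < +oo).

Definition epigraph Psi : set ('cV[R]_n * R) :=
  [set p | Psi p.1 <= p.2%:E].

Definition closed_fun Psi : Prop := closed (epigraph Psi).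

(* At t = 0 and t = 1 the convention 0 * +oo = 0 makes the inequality trivial.
   The right-hand side never meets +oo - oo when Psi avoids -oo. *)
Definition convex_fun Psi : Prop :=
  forall (x y : 'cV[R]_n) (t : R), (0 <= t <= 1)%R ->
    Psi (t *: x + (1 - t) *: y)%R <= t%:E * Psi x + (1 - t)%:E * Psi y.

End ExtendedRealValuedFunctions.

Section Prox.
Context {R : realType} {n : nat}.

(* [{dot V for idfun}] is the type of symmetric positive definite bilinear
   forms on V, i.e., of the real inner products on V. *)
Variable ip : {dot 'cV[R]_n for idfun}.

Definition posdef (B : 'M[R]_n) : Prop :=
  (forall x y : 'cV[R]_n, ip (B *m x) y = ip x (B *m y)) /\
  (forall x : 'cV[R]_n, x != 0 -> 0 < ip (B *m x) x).

Definition normB (B : 'M[R]_n) (x : 'cV[R]_n) : R :=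
  Num.sqrt (ip (B *m x) x).

(* The norm of the linear functional [ip g] with respect to [normB B].
   [sup] is real-valued with a default on unbounded sets, but the set below
   is nonempty, and it is bounded as soon as B is positive definite. *)
Definition dual_normB (B : 'M[R]_n) (g : 'cV[R]_n) : R :=
  sup [set ip g x | x in [set x : 'cV[R]_n | normB B x <= 1]].

Definition prox_obj (Psi : 'cV[R]_n -> \bar R) (B : 'M[R]_n)
    (x g z : 'cV[R]_n) : \bar R :=
  ((ip g z + 2^-1 * normB B (z - x) ^+ 2)%:E + Psi z)%E.

(* For Psi proper, closed and convex and B positive definite, the infimum
   is attained, so that it is the minimum of the objective. *)
Definition Prox (Psi : 'cV[R]_n -> \bar R) (B : 'M[R]_n)
    (x g : 'cV[R]_n) (delta : R) : set 'cV[R]_n :=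
  [set y | (prox_obj Psi B x g y
            <= ereal_inf (range (prox_obj Psi B x g)) + delta%:E)%E].

End Prox.

(* Main.v *)
(** Along the segment [w = (1 - t) y + t z] the objective with gradient [g + e]
    is 1-strongly convex for [normB], while its value at [w] is at least its
    value at [y] minus [delta].  Dividing by [t], the objective [F] with
    gradient [g] satisfies
      [F y - F z <= E D + delta / t - (1 - t) D^2 / 2]
    with [D] the norm of [z - y] and [E] the dual norm of [e].  Taking
    [t = sqrt (2 delta) / D] when this is at most 1 (letting [t] tend to 0 when
    [delta = 0]), and [t = 1] otherwise, bounds the right-hand side by
    [delta + sqrt (2 delta) E + E^2 / 2].  Comparing [y] with each [z] directly
    avoids the existence of a minimizer. *)
Require Import Defs.
From mathcomp Require Import all_boot all_order all_algebra.
From mathcomp Require Import all_classical all_reals all_analysis.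
From mathcomp Require Import ring lra.

Import Order.TTheory GRing.Theory Num.Theory.

Local Open Scope classical_set_scope.
Local Open Scope ring_scope.

(** The scalar core of the argument: [s] is sqrt(2 delta), [D] the norm of z - y, [E] the dual norm
    of e and [u] the gap F y - F z. The hypothesis is the segment inequality before division by
    [t]. *)
Lemma le_half_sqrD_of_segment (R : realFieldType) (s E D u : R) :
    0 <= s -> 0 <= E -> 0 <= D ->
    (forall t, 0 < t <= 1 ->
       t * u <= t * (E * D) + s ^+ 2 / 2 - t * (1 - t) / 2 * D ^+ 2) ->
  u <= s ^+ 2 / 2 + s * E + E ^+ 2 / 2.
Proof.
move=> s0 E0 D0 H.
have [Ds|sD] := leP D s.
  have := H 1; rewrite ltr01 lexx => /(_ isT) H1.
  have EDs : E * D <= E * s by rewrite ler_wpM2l.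
  have E2 := sqr_ge0 E; lra.
have Dgt0 : 0 < D by apply: le_lt_trans sD.
move: s0; rewrite le_eqVlt => /orP[/eqP s0|sgt0].
  move: H; rewrite -s0 => H.
  apply/ler_addgt0Pr => eps eps0.
  have den0 : 0 < D ^+ 2 + eps by rewrite ltr_wpDl // sqr_ge0.
  (* This [t] lies in (0, 1] and keeps [t * D ^+ 2] below [eps], so stopping short of the limit t =
     0 costs at most eps / 2. *)
  pose t := eps / (D ^+ 2 + eps).
  have t0 : 0 < t by rewrite divr_gt0.
  have t1 : t <= 1 by rewrite ler_pdivrMr// mul1r lerDr sqr_ge0.
  have tD : t * D ^+ 2 <= eps.
    rewrite /t mulrAC ler_pdivrMr// mulrDr lerDl.
    by rewrite mulr_ge0 ?ltW.
  have /H Ht : 0 < t <= 1 by rewrite t0.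
  have {}Ht : t * u <= t * (E * D - (1 - t) / 2 * D ^+ 2) by lra.
  rewrite ler_pM2l// in Ht.
  have ED := sqr_ge0 (E - D); nra.
pose t := s / D.
have t0 : 0 < t by rewrite divr_gt0.
have t1 : t <= 1 by rewrite ler_pdivrMr// mul1r ltW.
have tD : t * D = s by rewrite divfK// gt_eqF.
have /H Ht : 0 < t <= 1 by rewrite t0.
have {}Ht : t * u <= t * (E * D + s * D / 2 - (1 - t) / 2 * D ^+ 2).
  have ss : s ^+ 2 = t * (s * D) by rewrite mulrCA tD expr2.
  lra.
rewrite ler_pM2l// in Ht.
have tDD : t * D ^+ 2 = s * D by rewrite expr2 mulrA tD.
(* Since t D = s, the bound is now (E + s) D - D^2 / 2, which is at most (E + s)^2 / 2. *)
have ED := sqr_ge0 (E + s - D); nra.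
Qed.

Section InnerProduct.
Context {R : realType} {n : nat}.
Variables (ip : {dot 'cV[R]_n for idfun}) (B : 'M[R]_n).
Implicit Types u v w : 'cV[R]_n.

Let ipDl u v w : ip (u + v) w = ip u w + ip v w.
Proof. exact: linearDl. Qed.
Let ipDr u v w : ip w (u + v) = ip w u + ip w v.
Proof. exact: linearDr. Qed.
Let ipZl a v w : ip (a *: v) w = a * ip v w.
Proof. exact: linearZl_LR. Qed.
Let ipZr a v w : ip v (a *: w) = a * ip v w.
Proof. exact: linearZr_LR. Qed.
Let ipNl v w : ip (- v) w = - ip v w.
Proof. exact: linearNl. Qed.
Let ipNr v w : ip v (- w) = - ip v w.
Proof. exact: linearNr. Qed.
Let ipC v w : ip v w = ip w v.
Proof. by rewrite hermC expr0 mul1r. Qed.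

(** Bilinear expansion gives both sides the coefficients (1 - t)^2 and t^2 on the pure terms and t
    (1 - t) on each mixed term. *)
Lemma quad_segment (t : R) u v :
  ip (B *m ((1 - t) *: u + t *: v)) ((1 - t) *: u + t *: v) =
  (1 - t) * ip (B *m u) u + t * ip (B *m v) v
  - t * (1 - t) * ip (B *m (v - u)) (v - u).
Proof.
rewrite !mulmxDr !mulmxN -!scalemxAr.
by rewrite !(ipDl, ipDr, ipZl, ipZr, ipNl, ipNr); ring.
Qed.

Hypothesis hB : posdef ip B.

Lemma posdef_ge0 u : 0 <= ip (B *m u) u.
Proof.
have [->|u0] := eqVneq u 0; last by rewrite ltW// (proj2 hB).
by rewrite linear0r.
Qed.

Lemma sqr_normB u : normB ip B u ^+ 2 = ip (B *m u) u.
Proof. by rewrite sqr_sqrtr// posdef_ge0. Qed.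

Lemma normB_ge0 u : 0 <= normB ip B u.
Proof. exact: sqrtr_ge0. Qed.

Lemma normB_gt0 u : u != 0 -> 0 < normB ip B u.
Proof. by move=> u0; rewrite sqrtr_gt0 (proj2 hB). Qed.

Lemma normBZ a u : 0 <= a -> normB ip B (a *: u) = a * normB ip B u.
Proof.
move=> a0; rewrite /normB -scalemxAr ipZl ipZr mulrA -expr2.
by rewrite sqrtrM ?sqr_ge0// sqrtr_sqr ger0_norm.
Qed.

Lemma posdef_CauchySchwarz u v :
  ip (B *m u) v <= normB ip B u * normB ip B v.
Proof.
have [->|u0] := eqVneq u 0.
  by rewrite mulmx0 linear0l mulr_ge0// normB_ge0.
have [->|v0] := eqVneq v 0.
  by rewrite linear0r mulr_ge0// normB_ge0.
(* With a and b the norms of [u] and [v], this nonnegative quantity expands to 2 a b (a b - <B u,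
   v>), and a b > 0. *)
have := posdef_ge0 (normB ip B v *: u - normB ip B u *: v).
have sym : ip (B *m v) u = ip (B *m u) v by rewrite (proj1 hB) ipC.
rewrite mulmxDr mulmxN -!scalemxAr !(ipDl, ipDr, ipZl, ipZr, ipNl, ipNr) sym.
rewrite -!sqr_normB.
have := normB_gt0 _ u0; have := normB_gt0 _ v0.
move: (normB _ _ u) (normB _ _ v) (ip _ _) => a b c b0 a0 H.
rewrite -(@ler_pM2l _ (a * b)) ?mulr_gt0//; lra.
Qed.

(** A nonzero kernel vector would make the form vanish. Passing to the transpose turns column
    vectors into the row vectors of [row_free]. *)
Lemma posdef_unitmx : B \in unitmx.
Proof.
rewrite -unitmx_tr -row_free_unit; apply: inj_row_free => v vB0.
apply/eqP; rewrite -trmx_eq0; apply/negPn/negP => /(proj2 hB).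
by rewrite -[B]trmxK -trmx_mul vB0 trmx0 linear0l ltxx.
Qed.

Lemma dual_set_bounded e :
  has_ubound [set ip e x | x in [set x | normB ip B x <= 1]].
Proof.
(* Writing e as B (B^-1 e) lets Cauchy-Schwarz apply; this bound is the norm of [e] induced by
   B^-1. *)
exists (normB ip B (invmx B *m e)) => _ [v /= v1 <-].
rewrite -{1}[e](mulKVmx posdef_unitmx).
apply: le_trans (posdef_CauchySchwarz _ _) _.
by rewrite ler_piMr// normB_ge0.
Qed.

Lemma dual_normB_ge0 e : 0 <= dual_normB ip B e.
Proof.
apply: (ub_le_sup (dual_set_bounded e)).
exists 0 => /=; last exact: linear0r.
by rewrite /normB linear0r sqrtr0.
Qed.

Lemma ip_le_dual_normB e v : ip e v <= dual_normB ip B e * normB ip B v.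
Proof.
have [->|v0] := eqVneq v 0.
  by rewrite linear0r mulr_ge0 ?dual_normB_ge0 ?normB_ge0.
rewrite -ler_pdivrMr ?normB_gt0// mulrC -ipZr.
apply: (ub_le_sup (dual_set_bounded e)).
exists ((normB ip B v)^-1 *: v) => //=.
rewrite normBZ ?invr_ge0 ?normB_ge0//.
by rewrite mulVf// gt_eqF// normB_gt0.
Qed.

(** The linear term is exactly affine along the segment, so the whole defect comes from
    [quad_segment] at u - x and v - x. *)
Lemma smooth_segment (x g u v : 'cV[R]_n) (t : R) :
  let h z := ip g z + 2^-1 * normB ip B (z - x) ^+ 2 in
  h ((1 - t) *: u + t *: v) =
  (1 - t) * h u + t * h v - t * (1 - t) / 2 * normB ip B (v - u) ^+ 2.
Proof.
move=> h; rewrite /h.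
have -> : (1 - t) *: u + t *: v - x = (1 - t) *: (u - x) + t *: (v - x).
  by rewrite !scalerBr addrACA -opprD -scalerDl subrK scale1r.
have -> : v - u = (v - x) - (u - x) by rewrite opprB addrA subrK.
by rewrite !sqr_normB quad_segment (ipDr (_ *: _)) !ipZr; field.
Qed.

End InnerProduct.

Theorem corollary2p5 (R : realType) (n : nat)
    (ip : {dot 'cV[R]_n for idfun})
    (Psi : 'cV[R]_n -> \bar R)
    (hproper : proper_fun Psi) (hclosed : closed_fun Psi)
    (hconvex : convex_fun Psi)
    (B : 'M[R]_n) (hB : posdef ip B)
    (x g e : 'cV[R]_n) (delta : R) (hdelta : 0 <= delta) :
  Prox ip Psi B x (g + e) delta
  `<=` Prox ip Psi B x g
         (delta + Num.sqrt (2 * delta) * dual_normB ip B e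
          + 2^-1 * dual_normB ip B e ^+ 2).
Proof.
case: hproper => PsiNy [z0 Psiz0] y; rewrite /Prox /= => hy.
have {}hy z : (prox_obj ip Psi B x (g + e) y
    <= prox_obj ip Psi B x (g + e) z + delta%:E)%E.
  apply: le_trans hy _; rewrite leeD2r//.
  by apply: ereal_inf_lbound; exists z.
have Psi_fin z : (Psi z < +oo)%E -> exists r, Psi z = r%:E.
  by move=> zy; exists (fine (Psi z)); rewrite fineK// fin_numE PsiNy lt_eqF.
(* The objective at [y] is at most its finite value at [z0] plus delta, which rules out +oo. *)
have [py Psiy] : exists r, Psi y = r%:E.
  have [r0 Er0] := Psi_fin _ Psiz0; apply: Psi_fin.
  have := hy z0; rewrite /prox_obj Er0 -!EFinD.
  by case: (Psi y) => // r _; rewrite ltry.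
rewrite -leeBlDr//; apply: le_ereal_inf_tmp => _ [z _ <-].
have [zoo|] := eqVneq (Psi z) +oo%E; first by rewrite /prox_obj zoo addey// leey.
rewrite -ltey => /Psi_fin[pz Psiz].
rewrite leeBlDr// /prox_obj Psiy Psiz -!EFinD lee_fin.
set s := Num.sqrt (2 * delta).
have hs : delta = s ^+ 2 / 2 by rewrite sqr_sqrtr ?mulr_ge0//; field.
rewrite hs.
pose h a b := ip a b + 2^-1 * normB ip B (b - x) ^+ 2.
suff : h g y + py - (h g z + pz) <= s ^+ 2 / 2 + s * dual_normB ip B e
    + dual_normB ip B e ^+ 2 / 2 by rewrite /h; lra.
apply: (@le_half_sqrD_of_segment _ _ _ (normB ip B (z - y))).
- exact: sqrtr_ge0.
- exact: dual_normB_ge0.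
- exact: normB_ge0.
move=> t /andP[t0 t1].
set w := (1 - t) *: y + t *: z.
have hw : (Psi w <= (t * pz + (1 - t) * py)%:E)%E.
  rewrite /w addrC; apply: le_trans (hconvex z y t _) _; first by rewrite ltW.
  by rewrite Psiy Psiz.
have [pw Psiw] : exists r, Psi w = r%:E.
  by apply: Psi_fin; apply: le_lt_trans hw _; rewrite ltry.
move: hw (hy w); rewrite Psiw /prox_obj Psiy Psiw -!EFinD !lee_fin => hw.
have hadd v : ip (g + e) v = ip g v + ip e v by exact: linearDl.
have hsub : ip e (z - y) = ip e z - ip e y by exact: linearBr.
rewrite -/(h (g + e) y) -/(h (g + e) w) /w /h smooth_segment// -/w !hadd -hs.
(* Inserting the convexity bound on [pw] and cancelling the weight 1 - t at [y] leaves t (F y - F z)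
   <= t <e, z - y> + delta - t (1 - t) D^2 / 2. *)
move=> {}hy; have := ip_le_dual_normB ip B hB e (z - y).
rewrite hsub => /(ler_wpM2l (ltW t0)) he; lra.
Qed.
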